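(* Let $d \ge 1$ be fixed, let $S$ be a set of $n$ points in $\mathbb{R}^d$, and let $w : S \to \mathbb{R}_{\ge 0}$ be a weight function. For every fixed constant $\epsilon > 0$ and every integer $k \ge 1$, there exists a $(k, 4+\epsilon)$-vertex fault-tolerant additive weighted spanner (VFTAWS) for the metric space $(S, d_w)$ having $O(kn)$ edges, where the constant hidden in the $O$-notation depends only on $d$ and $\epsilon$.
   Context: For a weighted point set $(S,w)$ the additive weighted distance is $d_w(p,q) = 0$ if $p = q$ and $d_w(p,q) = w(p) + |pq| + w(q)$ if $p \neq q$, where $|pq|$ is the Euclidean distance. A graph $G$ with vertex set $S$ is viewed as edge-weighted, the weight of an edge $(p,q)$ being $d_w(p,q)$; $d_G(p,q)$ denotes the minimum total weight of a path between $p$ and $q$ in $G$. For $t > 1$, $G$ is a $t$-spanner for $(S,d_w)$ if $d_G(p,q) \le t \cdot d_w(p,q)$ for all $p, q \in S$. For an integer $k \ge 1$, $G$ is a $(k,t)$-VFTAWS for $(S,d_w)$ if for every subset $S' \subset S$ with $|S'| \le k$, the graph $G \setminus S'$ (delete the vertices of $S'$ and their incident edges) is a $t$-spanner for $S \setminus S'$ with respect to $d_w$, i.e. $d_{G \setminus S'}(p,q) \le t\cdot d_w(p,q)$ for all $p,q \in S\setminus S'$. *)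

(* Defs.v *)
From Stdlib Require Import Reals List Arith.
Import ListNotations.
Open Scope R_scope.

(* A point of R^d is given by its coordinates c = 0..d-1 (values at c >= d are irrelevant). *)
Definition point := nat -> R.

Definition euclid (d : nat) (p q : point) : R :=
  sqrt (fold_right Rplus 0 (map (fun c => (p c - q c) ^ 2) (seq 0 d))).

(* The point set S = {P 0, ..., P (n-1)} is indexed by 0..n-1; w i is the weight of P i.
   Additive weighted distance between the points with indices i and j. *)
Definition dw (d : nat) (P : nat -> point) (w : nat -> R) (i j : nat) : R :=
  if Nat.eq_dec i j then 0 else w i + euclid d (P i) (P j) + w j.

Definition graph_on (n : nat) (E : list (nat * nat)) : Prop :=
  NoDup E /\ Forall (fun e => (fst e < snd e)%nat /\ (snd e < n)%nat) E.

Definition adjacent (E : list (nat * nat)) (i j : nat) : Prop :=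
  In (i, j) E \/ In (j, i) E.

Fixpoint walk_ok (E : list (nat * nat)) (x : nat) (l : list nat) : Prop :=
  match l with
  | [] => True
  | y :: l' => adjacent E x y /\ walk_ok E y l'
  end.

Fixpoint walk_weight (D : nat -> nat -> R) (x : nat) (l : list nat) : R :=
  match l with
  | [] => 0
  | y :: l' => D x y + walk_weight D y l'
  end.

(* d_{G \ S'}(p,q) <= t * d_w(p,q): some walk from p to q in G avoiding S'
   has total d_w-weight at most t * d_w(p,q) (the minimum over walks is attained). *)
Definition short_path (d : nat) (P : nat -> point) (w : nat -> R)
    (E : list (nat * nat)) (S' : list nat) (t : R) (p q : nat) : Prop :=
  exists l : list nat,
    walk_ok E p l /\ last l p = q /\ Forall (fun v => ~ In v S') l /\
    walk_weight (dw d P w) p l <= t * dw d P w p q.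

Definition VFTAWS (d n k : nat) (t : R) (P : nat -> point) (w : nat -> R)
    (E : list (nat * nat)) : Prop :=
  graph_on n E /\
  forall S' : list nat, (length S' <= k)%nat -> Forall (fun v => (v < n)%nat) S' ->
  forall p q : nat, (p < n)%nat -> (q < n)%nat -> ~ In p S' -> ~ In q S' ->
    short_path d P w E S' t p q.

(* Main.v *)
Require Import Defs.
From Stdlib Require Import Reals List Arith ZArith Lia Lra Permutation Sorted ClassicalEpsilon.
Import ListNotations.
Open Scope R_scope.

(* Scan the points by increasing weight and make p a center unless k + 1 earlier centers lie
   within w(p)/5 of p; in that case join p to k + 1 of them, one of which survives the failures.
   It remains to connect surviving centers p, q at cost w(p) + w(q) + 4|pq|; then a walk
   p, c, ..., c', q through centers c, c' close to p and q has stretch 4.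
   For centers, use Yao edges: in each of finitely many direction cells at p, join p to the
   k + 1 nearest centers r with w(r) <= |pr|/2.  If w(q) <= |pq|/2, either pq is an edge or
   some surviving r has w(r) <= |pr|/2 and |rq| <= |pq| - 0.99|pr|, so that 2w(r) + |pr| is
   paid for by the decrease of 4|pq|; if w(p) <= |pq|/2, step from q instead.  If both
   inequalities fail, pq is made an edge: a packing argument, based on the separation of the
   centers, shows that each p has only O(k) such partners among the lighter centers. *)

(** * Euclidean distance and cells *)

Lemma Rabs_le_inv (x a : R) : Rabs x <= a -> - a <= x <= a.
Proof. unfold Rabs; destruct Rcase_abs; lra. Qed.

(** Peels off the last coordinate, so that metric facts can be proved by induction on the
    dimension. *)
Lemma euclid_succ (d : nat) (p q : point) :
  euclid (S d) p q = sqrt (euclid d p q ^ 2 + (p d - q d) ^ 2).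
Proof.
  assert (Hinit : forall (l : list R) (a : R),
      fold_right Rplus a l = fold_right Rplus 0 l + a)
    by (induction l as [|x l IH]; intros a; simpl; [|rewrite IH]; ring).
  assert (Hpos : forall l : list nat,
      0 <= fold_right Rplus 0 (map (fun c => (p c - q c) ^ 2) l)).
  { induction l as [|x l IH]; cbn -[pow]; [lra|].
    pose proof (pow2_ge_0 (p x - q x)); lra. }
  unfold euclid at 1. rewrite seq_S, map_app, fold_right_app, Hinit.
  f_equal. unfold euclid. rewrite pow2_sqrt by apply Hpos.
  simpl. ring.
Qed.

Lemma euclid_0 (p q : point) : euclid 0 p q = 0.
Proof. unfold euclid; simpl; apply sqrt_0. Qed.

Lemma euclid_nonneg (d : nat) (p q : point) : 0 <= euclid d p q.
Proof. apply sqrt_pos. Qed.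

(** Homogeneity stated on coordinate differences only, so that translation, reflection ([a = -1]),
    coincidence ([a = 0]) and points on a segment are all instances. *)
Lemma euclid_scale (d : nat) (a : R) (p q p' q' : point) :
  (forall c, (c < d)%nat -> p' c - q' c = a * (p c - q c)) ->
  euclid d p' q' = Rabs a * euclid d p q.
Proof.
  induction d as [|d IH]; intros H; [rewrite !euclid_0; ring|].
  rewrite !euclid_succ, IH, H by auto with arith.
  rewrite <- (sqrt_pow2 (Rabs a)) at 2 by apply Rabs_pos.
  rewrite <- sqrt_mult_alt by apply pow2_ge_0.
  f_equal. rewrite <- (pow2_abs (a * _)), Rabs_mult, !Rpow_mult_distr, !pow2_abs. ring.
Qed.

Lemma euclid_sym (d : nat) (p q : point) : euclid d p q = euclid d q p.
Proof.
  rewrite (euclid_scale d (-1) q p p q) by (intros; ring).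
  rewrite Rabs_left by lra. ring.
Qed.

Lemma euclid_coord (d c : nat) (p q : point) :
  (c < d)%nat -> Rabs (p c - q c) <= euclid d p q.
Proof.
  induction d as [|d IH]; intros H; [lia|].
  rewrite euclid_succ.
  pose proof (euclid_nonneg d p q). pose proof (Rabs_pos (p c - q c)).
  rewrite <- (sqrt_pow2 (Rabs (p c - q c))) by assumption.
  apply sqrt_le_1_alt.
  destruct (Nat.eq_dec c d) as [->|Hc].
  - rewrite pow2_abs. nra.
  - assert (Rabs (p c - q c) <= euclid d p q) by (apply IH; lia).
    pose proof (pow2_ge_0 (p d - q d)). nra.
Qed.

Lemma euclid_le_succ (d : nat) (p q : point) :
  euclid (S d) p q <= euclid d p q + Rabs (p d - q d).
Proof.
  rewrite euclid_succ, <- (pow2_abs (p d - q d)).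
  pose proof (euclid_nonneg d p q). pose proof (Rabs_pos (p d - q d)).
  rewrite <- (sqrt_pow2 (euclid d p q + Rabs (p d - q d))) by lra.
  apply sqrt_le_1_alt.
  nra.
Qed.

(** Minkowski in the plane, by Cauchy-Schwarz: the defect of the squares is (ay - bx)^2. In the
    induction on the dimension, [a] and [b] are the norms of the coordinates already treated. *)
Lemma sqrt_sum_triangle (a b x y : R) : 0 <= a -> 0 <= b ->
  sqrt ((a + b) ^ 2 + (x + y) ^ 2) <= sqrt (a ^ 2 + x ^ 2) + sqrt (b ^ 2 + y ^ 2).
Proof.
  intros Ha Hb.
  pose proof (sqrt_pos (a ^ 2 + x ^ 2)) as HA. pose proof (sqrt_pos (b ^ 2 + y ^ 2)) as HB.
  assert (EA : sqrt (a ^ 2 + x ^ 2) ^ 2 = a ^ 2 + x ^ 2) by (apply pow2_sqrt; nra).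
  assert (EB : sqrt (b ^ 2 + y ^ 2) ^ 2 = b ^ 2 + y ^ 2) by (apply pow2_sqrt; nra).
  set (A := sqrt (a ^ 2 + x ^ 2)) in *. set (B := sqrt (b ^ 2 + y ^ 2)) in *.
  assert (a * b + x * y <= A * B).
  { apply Rle_trans with (Rabs (a * b + x * y)); [apply Rle_abs|].
    apply Rsqr_incr_0; [|apply Rabs_pos|apply Rmult_le_pos; assumption].
    rewrite <- Rsqr_abs, !Rsqr_pow2, Rpow_mult_distr, EA, EB.
    pose proof (pow2_ge_0 (a * y - b * x)). nra. }
  rewrite <- (sqrt_pow2 (A + B)) by lra.
  apply sqrt_le_1_alt. nra.
Qed.

Lemma euclid_triangle (d : nat) (p r q : point) :
  euclid d p q <= euclid d p r + euclid d r q.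
Proof.
  induction d as [|d IH]; [rewrite !euclid_0; lra|].
  rewrite !euclid_succ.
  eapply Rle_trans; [|apply sqrt_sum_triangle; apply euclid_nonneg].
  apply sqrt_le_1_alt.
  replace (p d - r d + (r d - q d)) with (p d - q d) by ring.
  apply Rplus_le_compat_r, pow_incr. split; [apply euclid_nonneg|exact IH].
Qed.

(** A grid on the cube, one coordinate at a time: half of [eta] goes to the last coordinate and half
    to the others. The two cell numbers are merged in mixed radix. *)
Lemma unit_cube_cells (d : nat) (eta : R) : 0 < eta ->
  exists (M : nat) (f : point -> nat),
    (forall v, (forall c, (c < d)%nat -> Rabs (v c) <= 1) -> (f v < M)%nat) /\
    (forall v v', (forall c, (c < d)%nat -> Rabs (v c) <= 1) ->
       (forall c, (c < d)%nat -> Rabs (v' c) <= 1) ->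
       f v = f v' -> euclid d v v' <= eta).
Proof.
  revert eta; induction d as [|d IH]; intros eta Heta.
  { exists 1%nat, (fun _ => 0%nat). split; [auto with arith|].
    intros v v' _ _ _. rewrite euclid_0. lra. }
  destruct (IH (eta / 2) ltac:(lra)) as (M & f & Hf & Hff).
  (* As x + 1 lies in [0, 2], [g] numbers intervals of length eta/2 from 1 to at most up(4/eta),
     whence the [S] in [N]. *)
  set (g := fun x : R => Z.to_nat (up ((x + 1) * (2 / eta)))).
  set (N := S (Z.to_nat (up (4 / eta)))).
  assert (Hs : 0 < 2 / eta) by (apply Rdiv_lt_0_compat; lra).
  assert (Hup : forall x y, x <= y -> (up x <= up y)%Z).
  { intros x y Hxy. destruct (archimed x), (archimed y).
    assert (up x < up y + 1)%Z; [apply lt_IZR; rewrite plus_IZR|]; lia || lra. }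
  assert (HgN : forall x, Rabs x <= 1 -> (g x < N)%nat).
  { intros x Hx. apply Rabs_le_inv in Hx. unfold g, N.
    enough (up ((x + 1) * (2 / eta)) <= up (4 / eta))%Z by lia.
    apply Hup. replace (4 / eta) with (2 * (2 / eta)) by (field; lra). nra. }
  assert (Hgg : forall x y, Rabs x <= 1 -> Rabs y <= 1 -> g x = g y ->
            Rabs (x - y) <= eta / 2).
  { intros x y Hx Hy Hg. apply Rabs_le_inv in Hx, Hy. unfold g in Hg.
    destruct (archimed ((x + 1) * (2 / eta))) as [Hx1 Hx2],
             (archimed ((y + 1) * (2 / eta))) as [Hy1 Hy2].
    assert (E : up ((x + 1) * (2 / eta)) = up ((y + 1) * (2 / eta))).
    { apply Z2Nat.inj; [| |exact Hg]; apply le_IZR; nra. }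
    rewrite E in *.
    assert (Hd : -1 <= (x - y) * (2 / eta) <= 1) by (split; lra).
    apply Rabs_le.
    replace (x - y) with ((x - y) * (2 / eta) * (eta / 2)) by (field; lra).
    split; nra. }
  exists (M * N)%nat, (fun v => f v * N + g (v d))%nat. split.
  - intros v Hv.
    assert (f v < M)%nat by (apply Hf; auto with arith).
    assert (g (v d) < N)%nat by (apply HgN, Hv; lia). nia.
  - intros v v' Hv Hv' E.
    assert (g (v d) < N)%nat by (apply HgN, Hv; lia).
    assert (g (v' d) < N)%nat by (apply HgN, Hv'; lia).
    assert (f v = f v') by nia.
    assert (g (v d) = g (v' d)) by nia.
    eapply Rle_trans; [apply euclid_le_succ|].
    assert (euclid d v v' <= eta / 2) by (apply Hff; auto with arith).
    assert (Rabs (v d - v' d) <= eta / 2) by (apply Hgg; auto with arith).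
    lra.
Qed.

(** With a fixed [rho] it places q in a ball around p; with rho = |pq| it is the direction from p to
    q. One grid on the cube thus serves both for packing and for Yao cells. *)
Definition offset (p q : point) (rho : R) : point := fun c => (q c - p c) / rho.

Lemma offset_unit_cube (d : nat) (p q : point) (rho : R) :
  0 < rho -> euclid d p q <= rho ->
  forall c, (c < d)%nat -> Rabs (offset p q rho c) <= 1.
Proof.
  intros Hr Hle c Hc. unfold offset.
  unfold Rdiv. rewrite Rabs_mult, Rabs_inv, (Rabs_right rho) by lra.
  apply (Rmult_le_reg_r rho); [lra|]. rewrite Rmult_assoc, Rinv_l, Rmult_1_r by lra.
  rewrite Rabs_minus_sym. pose proof (euclid_coord d c p q Hc). lra.
Qed.

Lemma euclid_same_cell (d : nat) (p q r : point) (rho eta : R) : 0 < rho ->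
  euclid d (offset p q rho) (offset p r rho) <= eta -> euclid d q r <= eta * rho.
Proof.
  intros Hr H.
  rewrite (euclid_scale d rho (offset p q rho) (offset p r rho)).
  - rewrite Rabs_right by lra. nra.
  - intros c _. unfold offset. field. lra.
Qed.

(* The detour through s = p + |pr| u, with u the direction from p to q: it lies on the
   segment pq and is within eta |pr| of r. *)
Lemma euclid_same_direction (d : nat) (p q r : point) (eta : R) :
  0 < euclid d p r -> euclid d p r <= euclid d p q ->
  euclid d (offset p q (euclid d p q)) (offset p r (euclid d p r)) <= eta ->
  euclid d r q <= euclid d p q - (1 - eta) * euclid d p r.
Proof.
  intros Hr Hle H.
  set (a := euclid d p q) in *. set (b := euclid d p r) in *.
  set (s := fun c => p c + b * offset p q a c).
  pose proof (euclid_triangle d r s q) as T.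
  assert (E1 : euclid d r s = b * euclid d (offset p q a) (offset p r b)).
  { rewrite (euclid_scale d (- b) (offset p q a) (offset p r b)).
    - rewrite Rabs_Ropp, Rabs_right by lra. reflexivity.
    - intros c _. unfold s, offset. field. lra. }
  assert (E2 : euclid d s q = a - b).
  { rewrite (euclid_scale d ((a - b) / a) p q).
    - fold a. rewrite Rabs_right; [field; lra|].
      apply Rle_ge, Rmult_le_pos; [lra|]. apply Rlt_le, Rinv_0_lt_compat; lra.
    - intros c _. unfold s, offset. field. lra. }
  nra.
Qed.

(** * Selections of list elements *)

(** The predicate is decided classically, which allows conditions on real numbers. *)
Definition sel (Q : nat -> Prop) (l : list nat) : list nat :=
  filter (fun x => if excluded_middle_informative (Q x) then true else false) l.

Lemma in_sel (Q : nat -> Prop) (l : list nat) (x : nat) : In x (sel Q l) <-> In x l /\ Q x.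
Proof.
  unfold sel. rewrite filter_In.
  destruct (excluded_middle_informative (Q x)); intuition discriminate.
Qed.

Lemma NoDup_sel (Q : nat -> Prop) (l : list nat) : NoDup l -> NoDup (sel Q l).
Proof. apply NoDup_filter. Qed.

Lemma NoDup_firstn (m : nat) (l : list nat) : NoDup l -> NoDup (firstn m l).
Proof.
  intros H. rewrite <- (firstn_skipn m l) in H. exact (NoDup_app_remove_r _ _ H).
Qed.

Lemma flat_map_length_le {A B : Type} (f : A -> list B) (K : nat) (l : list A) :
  (forall x, In x l -> (length (f x) <= K)%nat) ->
  (length (flat_map f l) <= length l * K)%nat.
Proof.
  induction l as [|x l IH]; simpl; intros H; [lia|].
  rewrite length_app. specialize (H x (or_introl eq_refl)) as Hx.
  specialize (IH (fun y Hy => H y (or_intror Hy))). lia.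
Qed.

Lemma exists_surviving (B F : list nat) :
  NoDup B -> (length F < length B)%nat -> exists r, In r B /\ ~ In r F.
Proof.
  intros HB Hlt. apply NNPP. intros Hno.
  enough (length B <= length F)%nat by lia.
  apply NoDup_incl_length; [exact HB|].
  intros r Hr. apply NNPP. intros HF. apply Hno. now exists r.
Qed.

(** Real measures are not well-founded, but on a finite list the number of elements of smaller
    measure is a natural number that can replace them. *)
Lemma measure_ind {A : Type} (m : A -> R) (U : list A) (Q : A -> Prop) :
  (forall x, In x U -> (forall y, In y U -> m y < m x -> Q y) -> Q x) ->
  forall x, In x U -> Q x.
Proof.
  intros Hstep.
  set (below := fun x => filter (fun y => if Rlt_dec (m y) (m x) then true else false) U).
  enough (forall N x, (length (below x) < N)%nat -> In x U -> Q x)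
    by (intros x; apply (H (S (length (below x)))); lia).
  induction N as [|N IH]; intros x HN Hx; [lia|].
  apply Hstep; [exact Hx|]. intros y Hy Hlt. apply IH; [|exact Hy].
  enough (length (below y) < length (below x))%nat by lia.
  clear - Hy Hlt. unfold below.
  (* Everything below y is below x; the count is strictly smaller because y itself is below x but
     not below y. *)
  assert (Hle : forall V, (length (filter (fun z => if Rlt_dec (m z) (m y) then true else false) V)
     <= length (filter (fun z => if Rlt_dec (m z) (m x) then true else false) V))%nat).
  { induction V as [|z V IHV]; simpl; [lia|].
    destruct (Rlt_dec (m z) (m y)), (Rlt_dec (m z) (m x)); simpl; lia || lra. }
  induction U as [|z V IHV]; simpl; [destruct Hy|].
  destruct Hy as [->|Hy].
  - specialize (Hle V).
    destruct (Rlt_dec (m y) (m y)), (Rlt_dec (m y) (m x)); simpl; lia || lra.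
  - specialize (IHV Hy).
    destruct (Rlt_dec (m z) (m y)), (Rlt_dec (m z) (m x)); simpl; lia || lra.
Qed.

Fixpoint insert (f : nat -> R) (x : nat) (l : list nat) : list nat :=
  match l with
  | [] => [x]
  | y :: l' => if Rle_dec (f x) (f y) then x :: l else y :: insert f x l'
  end.

Definition sort (f : nat -> R) (l : list nat) : list nat := fold_right (insert f) [] l.

Lemma insert_perm (f : nat -> R) (x : nat) (l : list nat) :
  Permutation (x :: l) (insert f x l).
Proof.
  induction l as [|y l IH]; simpl; [auto|].
  destruct Rle_dec; [auto|]. rewrite perm_swap. auto.
Qed.

Lemma sort_perm (f : nat -> R) (l : list nat) : Permutation l (sort f l).
Proof.
  induction l as [|x l IH]; simpl; [auto|]. rewrite <- insert_perm. auto.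
Qed.

Lemma sort_sorted (f : nat -> R) (l : list nat) :
  StronglySorted (fun a b => f a <= f b) (sort f l).
Proof.
  induction l as [|x l IH]; simpl; [constructor|].
  induction IH as [|y l' Hs IHs Hy]; simpl; [repeat constructor|].
  rewrite Forall_forall in Hy.
  destruct (Rle_dec (f x) (f y)) as [Hle|Hle]; constructor.
  - now constructor; [|rewrite Forall_forall].
  - apply Forall_forall. intros z [->|Hz]; [exact Hle|]. specialize (Hy z Hz). lra.
  - exact IHs.
  - apply Forall_forall. intros z Hz.
    apply (Permutation_in _ (Permutation_sym (insert_perm f x l'))) in Hz.
    destruct Hz as [->|Hz]; [lra|auto].
Qed.

Definition smallest (m : nat) (f : nat -> R) (l : list nat) : list nat :=
  firstn m (sort f l).

Lemma in_smallest (m : nat) (f : nat -> R) (l : list nat) (x : nat) :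
  In x (smallest m f l) -> In x l.
Proof.
  intros H. apply (Permutation_in x (Permutation_sym (sort_perm f l))).
  rewrite <- (firstn_skipn m (sort f l)). apply in_or_app. now left.
Qed.

Lemma NoDup_smallest (m : nat) (f : nat -> R) (l : list nat) :
  NoDup l -> NoDup (smallest m f l).
Proof. intros H. apply NoDup_firstn, (Permutation_NoDup (sort_perm f l) H). Qed.

Lemma StronglySorted_app_rel {A : Type} (Q : A -> A -> Prop) (l1 l2 : list A) (x y : A) :
  StronglySorted Q (l1 ++ l2) -> In x l1 -> In y l2 -> Q x y.
Proof.
  induction l1 as [|z l1 IH]; simpl; intros Hs Hx Hy; [destruct Hx|].
  apply StronglySorted_inv in Hs as [Hs Hz]. rewrite Forall_forall in Hz.
  destruct Hx as [->|Hx]; [apply Hz, in_or_app|]; auto.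
Qed.

(** If q is cut off from the sorted list, the kept prefix is full and precedes q. *)
Lemma smallest_spec (m : nat) (f : nat -> R) (l : list nat) (q : nat) : In q l ->
  In q (smallest m f l) \/
  (length (smallest m f l) = m /\ forall r, In r (smallest m f l) -> f r <= f q).
Proof.
  intros Hq. apply (Permutation_in _ (sort_perm f l)) in Hq.
  pose proof (sort_sorted f l) as Hs. unfold smallest.
  rewrite <- (firstn_skipn m (sort f l)) in Hq, Hs.
  apply in_app_or in Hq as [Hq|Hq]; [now left|right]. split.
  - apply firstn_length_le. apply Nat.lt_le_incl.
    assert (length (skipn m (sort f l)) <> 0)%nat
      by (destruct (skipn m (sort f l)); [destruct Hq|discriminate]).
    rewrite length_skipn in H. lia.
  - intros r Hr. exact (StronglySorted_app_rel _ _ _ _ _ Hs Hr Hq).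
Qed.

(** Raw edge lists may hold loops, repetitions and both orientations of a pair; storing each pair
    once as (min, max) yields a legal graph without adding edges. *)
Lemma simple_graph_of_pairs (n : nat) (F : list (nat * nat)) :
  exists E, graph_on n E /\ (length E <= length F)%nat /\
    forall i j, In (i, j) F -> i <> j -> (i < n)%nat -> (j < n)%nat -> adjacent E i j.
Proof.
  induction F as [|[i j] F (E & [HN HF] & Hl & HE)].
  { exists []. split; [split; constructor|]. split; [constructor|contradiction]. }
  destruct (excluded_middle_informative
    (i <> j /\ (i < n)%nat /\ (j < n)%nat /\ ~ In (Nat.min i j, Nat.max i j) E))
    as [(Hij & Hi & Hj & Hnew)|Hno].
  - exists ((Nat.min i j, Nat.max i j) :: E). repeat split.
    + now constructor.
    + constructor; [simpl; lia|exact HF].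
    + simpl; lia.
    + intros a b [Hab|Hab] Hne Ha Hb.
      * injection Hab as <- <-. unfold adjacent; simpl.
        destruct (Nat.le_ge_cases i j);
          [left; rewrite Nat.min_l, Nat.max_r by lia|right; rewrite Nat.min_r, Nat.max_l by lia];
          auto.
      * destruct (HE a b Hab Hne Ha Hb); [left|right]; right; assumption.
  - exists E. repeat split; [exact HN|exact HF|simpl; lia|].
    intros a b [Hab|Hab] Hne Ha Hb; [|auto].
    injection Hab as <- <-.
    assert (HI : In (Nat.min i j, Nat.max i j) E) by (apply NNPP; tauto).
    unfold adjacent.
    destruct (Nat.le_ge_cases i j);
      [rewrite Nat.min_l, Nat.max_r in HI by lia|rewrite Nat.min_r, Nat.max_l in HI by lia]; auto.
Qed.

(** * Walks avoiding a set of failed vertices *)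

(** [short_path] with a free bound [W], so that walks can be concatenated. Only the vertices after
    the start have to avoid [F]. *)
Definition conn (D : nat -> nat -> R) (E : list (nat * nat)) (F : list nat)
    (p q : nat) (W : R) : Prop :=
  exists l, walk_ok E p l /\ last l p = q /\ Forall (fun v => ~ In v F) l /\
    walk_weight D p l <= W.

Lemma last_cons_default {A : Type} (y x : A) (l : list A) : last (y :: l) x = last l y.
Proof.
  revert y x. induction l as [|z l IH]; intros y x; [reflexivity|].
  change (last (y :: z :: l) x) with (last (z :: l) x). now rewrite !IH.
Qed.

Lemma conn_refl D E F p : conn D E F p p 0.
Proof. exists []. repeat split; simpl; [constructor|lra]. Qed.

Lemma conn_mono D E F p q W W' : conn D E F p q W -> W <= W' -> conn D E F p q W'.
Proof. intros (l & H1 & H2 & H3 & H4) H. exists l. repeat split; auto; lra. Qed.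

Lemma conn_edge D E F p q : adjacent E p q -> ~ In q F -> conn D E F p q (D p q).
Proof. intros Ha Hq. exists [q]. repeat split; simpl; auto; lra. Qed.

Lemma conn_trans D E F p r q W1 W2 :
  conn D E F p r W1 -> conn D E F r q W2 -> conn D E F p q (W1 + W2).
Proof.
  intros (l1 & H1 & H2 & H3 & H4) (l2 & K1 & K2 & K3 & K4).
  revert p W1 H1 H2 H3 H4. induction l1 as [|y l1 IH]; intros p W1 H1 H2 H3 H4.
  - simpl in *. subst r. exists l2. repeat split; auto; lra.
  - destruct H1 as [Ha H1]. rewrite last_cons_default in H2. inversion_clear H3. simpl in H4.
    destruct (IH y (W1 - D p y)) as (l & L1 & L2 & L3 & L4); auto; try lra.
    exists (y :: l). rewrite last_cons_default. repeat split; simpl; auto; lra.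
Qed.

(** Reversal makes [p] an entered vertex, hence the condition that it has not failed. *)
Lemma conn_sym D E F p q W : (forall x y, D x y = D y x) -> ~ In p F ->
  conn D E F p q W -> conn D E F q p W.
Proof.
  intros HD Hp (l & H1 & H2 & H3 & H4). revert p W Hp H1 H2 H3 H4.
  induction l as [|y l IH]; intros p W Hp H1 H2 H3 H4.
  - simpl in *. subst q. apply (conn_mono _ _ _ _ _ 0); [apply conn_refl|exact H4].
  - destruct H1 as [Ha H1]. rewrite last_cons_default in H2. inversion_clear H3. simpl in H4.
    apply (conn_mono _ _ _ _ _ ((W - D p y) + D y p)); [|rewrite (HD y p); lra].
    apply (conn_trans _ _ _ _ y); [apply IH; auto; lra|].
    apply conn_edge; [destruct Ha; [right|left]|]; assumption.
Qed.

(** * The spanner *)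

Section Construction.

Context (d k : nat) (P : nat -> point) (w : nat -> R) (M : nat) (cell : point -> nat).
Context (cell_lt : forall v, (forall c, (c < d)%nat -> Rabs (v c) <= 1) -> (cell v < M)%nat).
Context (cell_eq : forall v v',
  (forall c, (c < d)%nat -> Rabs (v c) <= 1) -> (forall c, (c < d)%nat -> Rabs (v' c) <= 1) ->
  cell v = cell v' -> euclid d v v' <= 1 / 100).

Let dist (i j : nat) : R := euclid d (P i) (P j).

(* [L] is meant to be sorted by decreasing weight, so that the tail [L'] consists of the
   points that are lighter than [p]. *)
Fixpoint centers (L : list nat) : list nat :=
  match L with
  | [] => []
  | p :: L' =>
      let C := centers L' in
      if le_dec (length (sel (fun c => dist p c <= w p / 5) C)) k then p :: C else C
  end.

Lemma centers_incl (L : list nat) : incl (centers L) L.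
Proof.
  induction L as [|p L IH]; simpl; [apply incl_nil_l|].
  destruct le_dec; [apply incl_cons; [now left|]|]; apply incl_tl, IH.
Qed.

Lemma NoDup_centers (L : list nat) : NoDup L -> NoDup (centers L).
Proof.
  induction 1 as [|p L Hp HL IH]; simpl; [constructor|].
  destruct le_dec; [constructor|]; auto. intros H. apply Hp, centers_incl, H.
Qed.

Lemma length_centers (L : list nat) : (length (centers L) <= length L)%nat.
Proof. induction L; simpl; [|destruct le_dec; simpl]; lia. Qed.

(** The weight is tested again because [C] will be the final set of centers, which includes ones
    heavier than [p]. *)
Definition near_centers (C : list nat) (p : nat) : list nat :=
  firstn (S k) (sel (fun c => w c <= w p /\ dist p c <= w p / 5) C).

Lemma in_near_centers (C : list nat) (p c : nat) :
  In c (near_centers C p) -> In c C /\ w c <= w p /\ dist p c <= w p / 5.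
Proof.
  unfold near_centers. intros H.
  apply (in_sel (fun c => w c <= w p /\ dist p c <= w p / 5)).
  rewrite <- (firstn_skipn (S k)). apply in_or_app. left. exact H.
Qed.

(** A rejected point had more than [k] close centers among the lighter points, and centers are never
    removed later. *)
Lemma non_center_near (L : list nat) (p : nat) :
  NoDup L -> StronglySorted (fun a b => - w a <= - w b) L -> In p L ->
  In p (centers L) \/ length (near_centers (centers L) p) = S k.
Proof.
  intros HN HS Hp.
  (* A witness list [B] is carried through the induction because its properties persist when further
     centers are added. *)
  enough (In p (centers L) \/ exists B, NoDup B /\ (k < length B)%nat /\ forall c, In c B ->
      In c (centers L) /\ w c <= w p /\ dist p c <= w p / 5) as [H|(B & HB & Hk & HBc)].
  { now left. }
  { right. apply firstn_length_le. apply Nat.le_trans with (length B); [exact Hk|].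
    apply NoDup_incl_length; [exact HB|]. intros c Hc. apply in_sel, HBc, Hc. }
  induction L as [|x L IH]; [destruct Hp|].
  inversion_clear HN as [|? ? Hx HN']. apply StronglySorted_inv in HS as [HS Hx'].
  rewrite Forall_forall in Hx'. simpl. destruct Hp as [->|Hp].
  - destruct le_dec as [Hle|Hgt]; [left; now left|right].
    exists (sel (fun c => dist p c <= w p / 5) (centers L)).
    split; [apply NoDup_sel, NoDup_centers, HN'|]. split; [lia|].
    intros c Hc. apply in_sel in Hc as [Hc Hd]. split; [exact Hc|]. split; [|exact Hd].
    specialize (Hx' c (centers_incl _ _ Hc)). lra.
  - destruct (IH HN' HS Hp) as [H|(B & HB & Hk & HBc)].
    + left. destruct le_dec; [right|]; exact H.
    + right. exists B. split; [exact HB|]. split; [exact Hk|].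
      intros c Hc. destruct (HBc c Hc) as (H1 & H2).
      split; [destruct le_dec; [right|]; exact H1|exact H2].
Qed.

(* All points of a selection of diameter at most [D] are close to its heaviest one, when that
   one became a center. *)
Lemma clustered_centers_few (L : list nat) (Q : nat -> Prop) (D : R) : NoDup L ->
  (forall a b, Q a -> Q b -> dist a b <= D) -> (forall a, Q a -> D <= w a / 5) ->
  (length (sel Q (centers L)) <= S k)%nat.
Proof.
  intros HN HD Hw. induction HN as [|p L Hp HN IH]; simpl; [lia|].
  destruct le_dec as [Hle|]; [|exact IH].
  unfold sel at 1; simpl; fold (sel Q (centers L)).
  destruct (excluded_middle_informative (Q p)) as [HQ|]; [|exact IH].
  simpl. apply le_n_S. eapply Nat.le_trans; [|exact Hle].
  apply NoDup_incl_length; [apply NoDup_sel, NoDup_centers, HN|].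
  intros c Hc. apply in_sel in Hc as [Hc Hq]. apply in_sel. split; [exact Hc|].
  specialize (HD p c HQ Hq). specialize (Hw p HQ). lra.
Qed.

(** * Heavy pairs: centers whose weights both exceed half their distance *)

Definition heavy (p q : nat) : Prop := dist p q < 2 * w p /\ dist p q < 2 * w q.

(** In a list of decreasing weight, each pair is charged to its heavier end. *)
Fixpoint heavy_pairs (C : list nat) : list (nat * nat) :=
  match C with
  | [] => []
  | p :: C' => map (pair p) (sel (heavy p) C') ++ heavy_pairs C'
  end.

Lemma in_heavy_pairs (C : list nat) (p q : nat) : In p C -> In q C -> p <> q -> heavy p q ->
  In (p, q) (heavy_pairs C) \/ In (q, p) (heavy_pairs C).
Proof.
  intros Hp Hq Hne Hh. induction C as [|x C IH]; [destruct Hp|].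
  simpl. rewrite !in_app_iff.
  destruct Hp as [->|Hp], Hq as [->|Hq].
  - contradiction.
  - left. left. apply in_map, in_sel. auto.
  - right. left. apply in_map, in_sel. split; [exact Hp|].
    unfold heavy, dist in *. rewrite (euclid_sym d (P q)). tauto.
  - destruct (IH Hp Hq); auto.
Qed.

(* Apart from at most [k] very close ones, the lighter heavy partners of [p] have weight
   comparable to [w p], so that each cell of the ball of radius [2 * w p] holds few of them. *)
Lemma heavy_partners_few (L : list nat) (p : nat) : NoDup L ->
  (forall c, In c L -> w c <= w p) ->
  (length (sel (fun c => dist p c <= w p / 5)%R (centers L)) <= k)%nat ->
  (length (sel (heavy p) (centers L)) <= k + M * S k)%nat.
Proof.
  intros HN Hmax Hk.
  set (Q := fun m r => heavy p r /\ w p / 5 < dist p r /\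
                       cell (offset (P p) (P r) (2 * w p)) = m).
  assert (Hunit : forall r, heavy p r -> 0 < w p /\
    forall c, (c < d)%nat -> Rabs (offset (P p) (P r) (2 * w p) c) <= 1).
  { intros r [H1 _]. unfold dist in H1. pose proof (euclid_nonneg d (P p) (P r)).
    split; [lra|]. apply offset_unit_cube; lra. }
  assert (Hcell : (length (flat_map (fun m => sel (Q m) (centers L)) (seq 0 M)) <= M * S k)%nat).
  { rewrite <- (length_seq M 0) at 2. apply flat_map_length_le. intros m _.
    (* A cell of diameter 1/100, scaled by 2w(p), has diameter w(p)/50. For [r] in [Q m], w(p)/5 <
       |pr| < 2w(r), so w(r)/5 exceeds w(p)/50. *)
    apply clustered_centers_few with (D := w p / 50); [exact HN| |].
    - intros a b (Ha & _ & Ea) (Hb & _ & Eb).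
      destruct (Hunit a Ha) as [Hp Ua]. destruct (Hunit b Hb) as [_ Ub].
      replace (w p / 50) with (1 / 100 * (2 * w p)) by field.
      apply euclid_same_cell with (P p); [lra|]. apply cell_eq; auto. congruence.
    - intros a ((_ & H1) & H2 & _). lra. }
  set (close := sel (fun c => dist p c <= w p / 5) (centers L)) in *.
  apply Nat.le_trans with
    (length (close ++ flat_map (fun m => sel (Q m) (centers L)) (seq 0 M))).
  2: rewrite length_app; lia.
  apply NoDup_incl_length; [apply NoDup_sel, NoDup_centers, HN|].
  intros r Hr. apply in_sel in Hr as [Hr Hh]. apply in_or_app.
  destruct (Rle_lt_dec (dist p r) (w p / 5)) as [Hd|Hd].
  - left. apply in_sel. auto.
  - right. apply in_flat_map. exists (cell (offset (P p) (P r) (2 * w p))). split.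
    + apply in_seq. split; [lia|]. apply cell_lt, Hunit, Hh.
    + apply in_sel. unfold Q. auto.
Qed.

(** The acceptance test of a center is exactly the bound on very close centers that
    [heavy_partners_few] asks for. *)
Lemma length_heavy_pairs (L : list nat) :
  NoDup L -> StronglySorted (fun a b => - w a <= - w b) L ->
  (length (heavy_pairs (centers L)) <= length L * (k + M * S k))%nat.
Proof.
  intros HN. induction HN as [|p L Hp HN IH]; intros HS; simpl; [lia|].
  apply StronglySorted_inv in HS as [HS Hx]. rewrite Forall_forall in Hx.
  specialize (IH HS). destruct le_dec as [Hle|]; [|lia].
  simpl. rewrite length_app, length_map.
  enough (length (sel (heavy p) (centers L)) <= k + M * S k)%nat by lia.
  apply heavy_partners_few; [exact HN| |exact Hle].
  intros c Hc. specialize (Hx c Hc). lra.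
Qed.

(** * Yao edges and the total edge count *)

Definition light_in_cell (p m r : nat) : Prop :=
  r <> p /\ w r <= dist p r / 2 /\ cell (offset (P p) (P r) (dist p r)) = m.

Definition yao_neighbors (C : list nat) (p : nat) : list nat :=
  flat_map (fun m => smallest (S k) (dist p) (sel (light_in_cell p m) C)) (seq 0 M).

Lemma length_yao_neighbors (C : list nat) (p : nat) :
  (length (yao_neighbors C p) <= M * S k)%nat.
Proof.
  rewrite <- (length_seq M 0). apply flat_map_length_le. intros m _.
  unfold smallest. apply firstn_le_length.
Qed.

Definition raw_edges (L : list nat) : list (nat * nat) :=
  flat_map (fun p => map (pair p) (near_centers (centers L) p)) L ++
  flat_map (fun p => map (pair p) (yao_neighbors (centers L) p)) (centers L) ++
  heavy_pairs (centers L).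

(** Each point pays for at most k + 1 edges to near centers, M(k + 1) Yao edges and k + M(k + 1)
    heavy edges. *)
Lemma length_raw_edges (L : list nat) :
  NoDup L -> StronglySorted (fun a b => - w a <= - w b) L ->
  (length (raw_edges L) <= length L * ((2 * M + 2) * S k))%nat.
Proof.
  intros HN HS. unfold raw_edges. rewrite !length_app.
  pose proof (length_heavy_pairs L HN HS).
  pose proof (length_centers L).
  assert (length (flat_map (fun p => map (pair p) (near_centers (centers L) p)) L)
            <= length L * S k)%nat.
  { apply flat_map_length_le. intros p _. rewrite length_map. apply firstn_le_length. }
  assert (length (flat_map (fun p => map (pair p) (yao_neighbors (centers L) p)) (centers L))
            <= length (centers L) * (M * S k))%nat.
  { apply flat_map_length_le. intros p _. rewrite length_map. apply length_yao_neighbors. }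
  assert (length (centers L) * (M * S k) <= length L * (M * S k))%nat
    by now apply Nat.mul_le_mono_r.
  lia.
Qed.

(** * Stretch of the walks that survive the failures *)

Context (n : nat) (L : list nat) (E : list (nat * nat)) (F : list nat).
Context (NoDup_L : NoDup L) (in_L : forall p, In p L <-> (p < n)%nat).
Context (L_sorted : StronglySorted (fun a b => - w a <= - w b) L).
Context (dist_pos : forall i j, (i < n)%nat -> (j < n)%nat -> i <> j -> 0 < dist i j).
Context (w_nonneg : forall i, (i < n)%nat -> 0 <= w i).
Context (E_raw : forall i j, In (i, j) (raw_edges L) -> i <> j ->
  (i < n)%nat -> (j < n)%nat -> adjacent E i j).
Context (F_small : (length F <= k)%nat).

Let D := dw d P w.
Let C := centers L.

Lemma dw_sym (i j : nat) : D i j = D j i.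
Proof.
  unfold D, dw. rewrite (euclid_sym d (P j)).
  destruct (Nat.eq_dec i j), (Nat.eq_dec j i); congruence || ring.
Qed.

Lemma dw_neq (i j : nat) : i <> j -> D i j = w i + dist i j + w j.
Proof. unfold D, dw. destruct Nat.eq_dec; [contradiction|reflexivity]. Qed.

Lemma center_lt (p : nat) : In p C -> (p < n)%nat.
Proof. intros H. apply in_L, centers_incl, H. Qed.

Lemma yao_edge (p r : nat) : In p C -> In r C -> p <> r -> In r (yao_neighbors C p) ->
  adjacent E p r.
Proof.
  intros Hp Hr Hne H. apply E_raw; auto using center_lt.
  unfold raw_edges. rewrite !in_app_iff. right. left.
  apply in_flat_map. exists p. split; [exact Hp|]. now apply in_map.
Qed.

Lemma heavy_edge (p q : nat) : In p C -> In q C -> p <> q -> heavy p q -> adjacent E p q.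
Proof.
  intros Hp Hq Hne Hh.
  destruct (in_heavy_pairs C p q Hp Hq Hne Hh) as [H|H].
  - apply E_raw; auto using center_lt. unfold raw_edges. rewrite !in_app_iff. auto.
  - enough (adjacent E q p) by (unfold adjacent in *; tauto).
    apply E_raw; auto using center_lt. unfold raw_edges. rewrite !in_app_iff. auto.
Qed.

(** If q is not among the chosen neighbors in its own cell, then k + 1 centers there are at most as
    far from p as q; one survives, and its direction agrees with that of q up to 1/100. *)
Lemma yao_step (p q : nat) : In p C -> In q C -> p <> q -> ~ In q F -> w q <= dist p q / 2 ->
  exists r, In r C /\ r <> p /\ ~ In r F /\ adjacent E p r /\
    (r = q \/ (w r <= dist p r / 2 /\ dist r q <= dist p q - 99 / 100 * dist p r)).
Proof.
  intros Hp Hq Hne HqF Hw.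
  pose proof (center_lt p Hp) as Hpn. pose proof (center_lt q Hq) as Hqn.
  set (m := cell (offset (P p) (P q) (dist p q))).
  set (B := smallest (S k) (dist p) (sel (light_in_cell p m) C)).
  assert (HB : forall r, In r B -> In r C /\ light_in_cell p m r)
    by (intros r Hr; apply in_sel; exact (in_smallest _ _ _ _ Hr)).
  assert (Hunit : forall r, In r C -> r <> p ->
    forall c, (c < d)%nat -> Rabs (offset (P p) (P r) (dist p r) c) <= 1).
  { intros r Hr Hrp. apply offset_unit_cube; [apply dist_pos; auto using center_lt|apply Rle_refl]. }
  assert (Hadj : forall r, In r B -> adjacent E p r).
  { intros r Hr. destruct (HB r Hr) as [HrC [Hrp _]]. apply yao_edge; auto.
    apply in_flat_map. exists m. split; [|exact Hr].
    apply in_seq. split; [lia|]. apply cell_lt, Hunit; auto. }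
  assert (Hqs : In q (sel (light_in_cell p m) C))
    by (apply in_sel; unfold light_in_cell; auto).
  destruct (smallest_spec (S k) (dist p) _ q Hqs) as [HqB|[Hlen Hmin]].
  { exists q. split; [exact Hq|]. auto. }
  destruct (exists_surviving B F) as (r & Hr & HrF).
  { apply NoDup_smallest, NoDup_sel, NoDup_centers, NoDup_L. }
  { unfold B. lia. }
  destruct (HB r Hr) as [HrC (Hrp & Hrw & Hrm)].
  exists r. repeat split; auto. right. split; [exact Hrw|].
  replace (99 / 100) with (1 - 1 / 100) by field.
  apply euclid_same_direction; [apply dist_pos; auto using center_lt|apply Hmin, Hr|].
  apply cell_eq; [apply Hunit; auto|apply Hunit; auto|exact (eq_sym Hrm)].
Qed.

(** Induction on the distance, over all pairs of centers. *)
Lemma center_walk (p q : nat) : In p C -> In q C -> p <> q -> ~ In p F -> ~ In q F ->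
  conn D E F p q (w p + w q + 4 * dist p q).
Proof.
  enough (H : forall x, In x (list_prod C C) -> fst x <> snd x -> ~ In (fst x) F ->
    ~ In (snd x) F -> conn D E F (fst x) (snd x) (w (fst x) + w (snd x) + 4 * dist (fst x) (snd x)))
    by (intros Hp Hq; exact (H (p, q) (in_prod _ _ _ _ Hp Hq))).
  clear p q. refine (measure_ind (fun x => dist (fst x) (snd x)) (list_prod C C) _ _).
  intros [p q] Hx IH. simpl. apply in_prod_iff in Hx as [Hp Hq].
  (* The induction hypothesis is an argument of [Hstep], since the step is applied to both (p, q)
     and (q, p), which have the same measure. *)
  assert (Hstep : forall p q, In p C -> In q C -> p <> q -> ~ In p F -> ~ In q F ->
    w q <= dist p q / 2 ->
    (forall y, In y (list_prod C C) -> dist (fst y) (snd y) < dist p q ->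
      fst y <> snd y -> ~ In (fst y) F -> ~ In (snd y) F ->
      conn D E F (fst y) (snd y) (w (fst y) + w (snd y) + 4 * dist (fst y) (snd y))) ->
    conn D E F p q (w p + w q + 4 * dist p q)).
  { clear p q Hp Hq IH. intros p q Hp Hq Hne HpF HqF Hw IH.
    destruct (yao_step p q Hp Hq Hne HqF Hw) as (r & Hr & Hrp & HrF & Ha & Hr').
    pose proof (conn_edge D E F p r Ha HrF) as Hpr. rewrite dw_neq in Hpr by auto.
    pose proof (dist_pos p r (center_lt p Hp) (center_lt r Hr) (not_eq_sym Hrp)).
    destruct (Nat.eq_dec r q) as [->|Hrq]; [apply (conn_mono _ _ _ _ _ _ _ Hpr); lra|].
    destruct Hr' as [->|[Hrw Hd]]; [contradiction|].
    assert (Hrq' : conn D E F r q (w r + w q + 4 * dist r q)).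
    { apply (IH (r, q)); simpl; auto; [apply in_prod; auto|lra]. }
    (* The detour costs an extra 2w(r) + |pr| <= 2|pr|, while 4|rq| is smaller than 4|pq| by at
       least 3.96|pr|. *)
    apply (conn_mono _ _ _ _ _ _ _ (conn_trans _ _ _ _ _ _ _ _ Hpr Hrq')). lra. }
  intros Hne HpF HqF.
  pose proof (dist_pos p q (center_lt p Hp) (center_lt q Hq) Hne) as Hpos.
  destruct (Rle_lt_dec (w q) (dist p q / 2)) as [Hwq|Hwq]; [apply Hstep; auto|].
  destruct (Rle_lt_dec (w p) (dist p q / 2)) as [Hwp|Hwp].
  - assert (Es : dist p q = dist q p) by apply euclid_sym.
    apply conn_sym; [apply dw_sym|exact HqF|].
    apply (conn_mono _ _ _ _ _ (w q + w p + 4 * dist q p)); [|lra].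
    apply Hstep; auto; [lra|]. intros y Hy Hlt. apply IH; [exact Hy|simpl; lra].
  - assert (Ha : adjacent E p q) by (apply heavy_edge; unfold heavy; auto; split; lra).
    apply (conn_mono _ _ _ _ _ _ _ (conn_edge D E F p q Ha HqF)). rewrite dw_neq by auto. lra.
Qed.

(** One edge costs w(p) + |pc| + w(c) <= (1 + 1/5 + 1)w(p); a surviving center uses the empty walk
    to itself. *)
Lemma walk_to_center (p : nat) : (p < n)%nat -> ~ In p F ->
  exists c, In c C /\ ~ In c F /\ w c <= w p /\ dist p c <= w p / 5 /\
    conn D E F p c (11 / 5 * w p).
Proof.
  intros Hp HpF. pose proof (w_nonneg p Hp) as Hw0.
  assert (Hself : In p C -> exists c, In c C /\ ~ In c F /\ w c <= w p /\ dist p c <= w p / 5 /\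
    conn D E F p c (11 / 5 * w p)).
  { intros HpC. exists p. repeat split; auto; [lra| |].
    - unfold dist. rewrite (euclid_scale d 0 (P p) (P p)) by (intros; ring).
      rewrite Rabs_R0. lra.
    - apply (conn_mono _ _ _ _ _ 0); [apply conn_refl|lra]. }
  destruct (non_center_near L p NoDup_L L_sorted (proj2 (in_L p) Hp)) as [HpC|Hlen]; [auto|].
  destruct (exists_surviving (near_centers C p) F) as (c & Hc & HcF).
  { apply NoDup_firstn, NoDup_sel, NoDup_centers, NoDup_L. }
  { unfold C. lia. }
  destruct (in_near_centers C p c Hc) as (HcC & Hwc & Hdc).
  destruct (Nat.eq_dec p c) as [<-|Hne]; [auto|].
  exists c. repeat split; auto.
  assert (Ha : adjacent E p c).
  { apply E_raw; auto using center_lt. unfold raw_edges. rewrite in_app_iff. left.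
    apply in_flat_map. exists p. split; [now apply in_L|now apply in_map]. }
  apply (conn_mono _ _ _ _ _ _ _ (conn_edge D E F p c Ha HcF)). rewrite dw_neq by auto. lra.
Qed.

Lemma surviving_walk (p q : nat) : (p < n)%nat -> (q < n)%nat -> ~ In p F -> ~ In q F ->
  conn D E F p q (4 * D p q).
Proof.
  intros Hp Hq HpF HqF.
  destruct (Nat.eq_dec p q) as [->|Hne].
  { apply (conn_mono _ _ _ _ _ 0); [apply conn_refl|].
    unfold D, dw. destruct Nat.eq_dec; [lra|contradiction]. }
  destruct (walk_to_center p Hp HpF) as (c & Hc & HcF & Hwc & Hdc & Wc).
  destruct (walk_to_center q Hq HqF) as (c' & Hc' & HcF' & Hwc' & Hdc' & Wc').
  apply (conn_sym _ _ _ _ _ _ dw_sym HqF) in Wc'.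
  pose proof (w_nonneg p Hp). pose proof (w_nonneg q Hq).
  pose proof (dist_pos p q Hp Hq Hne).
  rewrite dw_neq by exact Hne.
  destruct (Nat.eq_dec c c') as [<-|Hcc].
  { apply (conn_mono _ _ _ _ _ _ _ (conn_trans _ _ _ _ _ _ _ _ Wc Wc')). lra. }
  pose proof (center_walk c c' Hc Hc' Hcc HcF HcF') as W.
  apply (conn_mono _ _ _ _ _ _ _
    (conn_trans _ _ _ _ _ _ _ _ Wc (conn_trans _ _ _ _ _ _ _ _ W Wc'))).
  (* The coefficient of w(p) becomes 11/5 for reaching c, 1 for w(c) and 4/5 from 4|cc'|, which is
     exactly 4; likewise for w(q). *)
  assert (dist c c' <= w p / 5 + dist p q + w q / 5).
  { unfold dist in *.
    pose proof (euclid_triangle d (P c) (P p) (P c')).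
    pose proof (euclid_triangle d (P p) (P q) (P c')).
    rewrite (euclid_sym d (P c) (P p)) in *. lra. }
  lra.
Qed.

End Construction.

Theorem theorem1 :
  forall (d : nat), (1 <= d)%nat ->
  forall (eps : R), 0 < eps ->
  exists C : R, 0 < C /\
    forall (k n : nat), (1 <= k)%nat ->
    forall (P : nat -> point) (w : nat -> R),
      (* S is a set of n (distinct) points of R^d *)
      (forall i j : nat, (i < n)%nat -> (j < n)%nat -> i <> j ->
         exists c : nat, (c < d)%nat /\ P i c <> P j c) ->
      (* nonnegative weights *)
      (forall i : nat, (i < n)%nat -> 0 <= w i) ->
      exists E : list (nat * nat),
        VFTAWS d n k (4 + eps) P w E /\
        INR (length E) <= C * INR k * INR n.
Proof.
  intros d _ eps Heps.
  destruct (unit_cube_cells d (1 / 100) ltac:(lra)) as (M & cell & Hlt & Heq).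
  (* From (2M + 2)(k + 1) <= (4M + 4)k for k >= 1, where M is the number of cells of the grid in
     dimension [d]. *)
  exists (INR (4 * M + 4)). split; [apply lt_0_INR; lia|].
  intros k n Hk P w Hdist Hw.
  (* Sorting by -w lists the points by decreasing weight, as [centers] expects. *)
  set (L := sort (fun i => - w i) (seq 0 n)).
  pose proof (sort_perm (fun i => - w i) (seq 0 n)) as HL. fold L in HL.
  assert (HN : NoDup L) by exact (Permutation_NoDup HL (seq_NoDup n 0)).
  assert (HS : StronglySorted (fun a b => - w a <= - w b) L) by apply sort_sorted.
  assert (Hin : forall p, In p L <-> (p < n)%nat).
  { intros p. transitivity (In p (seq 0 n)); [|rewrite in_seq; lia].
    split; apply Permutation_in; [symmetry|]; exact HL. }
  assert (Hpos : forall i j, (i < n)%nat -> (j < n)%nat -> i <> j -> 0 < euclid d (P i) (P j)).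
  { intros i j Hi Hj Hij. destruct (Hdist i j Hi Hj Hij) as (c & Hc & Hne).
    eapply Rlt_le_trans; [|exact (euclid_coord d c _ _ Hc)]. apply Rabs_pos_lt. lra. }
  destruct (simple_graph_of_pairs n (raw_edges d k P w M cell L)) as (E & HG & Hlen & HE).
  exists E. split; [split; [exact HG|]|].
  - intros F HF _ p q Hp Hq HpF HqF.
    pose proof (surviving_walk d k P w M cell Hlt Heq n L E F HN Hin HS Hpos Hw HE HF
      p q Hp Hq HpF HqF) as Hconn.
    apply (conn_mono _ _ _ _ _ _ _ Hconn).
    (* The walk has stretch 4, so nonnegativity of the distance gives the bound with 4 + eps. *)
    enough (0 <= dw d P w p q) by nra.
    unfold dw. destruct Nat.eq_dec; [lra|].
    pose proof (Hw p Hp). pose proof (Hw q Hq). pose proof (Hpos p q Hp Hq n0). lra.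
  - rewrite <- !mult_INR. apply le_INR.
    pose proof (length_raw_edges d k P w M cell Hlt Heq L HN HS) as Hr.
    rewrite <- (Permutation_length HL), length_seq in Hr. nia.
Qed.
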